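(* Let $n$ be a positive integer. For $\varphi\in\mathcal{SV}(n)$ define an $n\times n$ matrix $f(\varphi)=(a_{i,j})_{1\le i,j\le n}$ by: $a_{i,j}=1$ if the choice of the interior vertex $(i,j)$ in $\varphi$ is $NS$, $a_{i,j}=-1$ if it is $EW$, and $a_{i,j}=0$ otherwise. Then $f(\varphi)\in\mathcal{A}_n$ for every $\varphi\in\mathcal{SV}(n)$, and $f\colon\mathcal{SV}(n)\to\mathcal{A}_n$ is a bijection. Moreover, for $\varphi\in\mathcal{SV}(n)$ with $f(\varphi)=(a_{i,j})$, put $c_{i,j}=\sum_{1\le k\le i}a_{k,j}$ and $r_{i,j}=\sum_{1\le l\le j}a_{i,l}$. Then for all $1\le i,j\le n$ the triplet $(a_{i,j},c_{i,j},r_{i,j})$ is one of the six values $(0,0,0),(0,0,1),(0,1,0),(0,1,1),(1,1,1),(-1,0,0)$, and the choice of $(i,j)$ in $\varphi$ is $NE$ if the triplet is $(0,0,0)$, $NW$ if it is $(0,0,1)$, $ES$ if it is $(0,1,0)$, $SW$ if it is $(0,1,1)$, $NS$ if it is $(1,1,1)$, and $EW$ if it is $(-1,0,0)$.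
   Context: An alternating sign matrix (ASM) of size $n$ is a matrix $(a_{i,j})_{1\le i,j\le n}$ with $a_{i,j}\in\{0,1,-1\}$, with all partial sums $\sum_{j=1}^{k}a_{i,j}$ and $\sum_{i=1}^{k}a_{i,j}$ in $\{0,1\}$ for $1\le k\le n$, and with every full row sum and full column sum equal to $1$. $\mathcal{A}_n$ is the set of ASMs of size $n$. Graph $L_n$: the interior vertices are the $(i,j)\in\mathbb{Z}^2$ with $1\le i,j\le n$; the boundary vertices are $(i,0),(i,n+1)$ for $1\le i\le n$ and $(0,j),(n+1,j)$ for $1\le j\le n$. The edges are the horizontal pairs $\{(i,j),(i,j+1)\}$ with $1\le i\le n$, $0\le j\le n$, and the vertical pairs $\{(i,j),(i+1,j)\}$ with $0\le i\le n$, $1\le j\le n$. Here $i$ is the row index (increasing downwards) and $j$ the column index (increasing to the right). An orientation assigns to each edge $\{u,v\}$ either $(u,v)$ or $(v,u)$; if it assigns $(u,v)$, the edge goes out of $u$ and comes in $v$. A state of the six vertex model on $L_n$ is an orientation for which every interior vertex has exactly two incident edges coming in and two going out. It has the open boundary condition if every vertical edge joining an interior vertex to a boundary vertex (at the top and bottom) comes in the boundary vertex, and every horizontal edge joining an interior vertex to a boundary vertex (at the left and right) goes out of the boundary vertex. $\mathcal{SV}(n)$ is the set of states of the six vertex model on $L_n$ with the open boundary condition. For an interior vertex $(i,j)$ write $N=\{(i,j),(i-1,j)\}$, $E=\{(i,j),(i,j+1)\}$, $S=\{(i,j),(i+1,j)\}$, $W=\{(i,j),(i,j-1)\}$. The choice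 of $(i,j)$ in a state is the pair of these edges that go out of $(i,j)$, one of $NE,NS,NW,ES,EW,SW$. *)

(* Defs.v *)
From HB Require Import structures.
From mathcomp Require Import all_boot all_order all_algebra.

Set Implicit Arguments.
Unset Strict Implicit.
Unset Printing Implicit Defensive.

Import Order.TTheory GRing.Theory Num.Theory.
Local Open Scope ring_scope.

(* Matrices are indexed from 0: entry [A i j] with [i j : 'I_n] is the entry
   a_{i+1,j+1} of the usual notation, so the sums below range over the first
   [k.+1] entries of a row (resp. column), 1 <= k.+1 <= n. *)
Definition row_psum n (A : 'M[int]_n) (i k : 'I_n) : int :=
  \sum_(l < n | (l <= k)%N) A i l.

Definition col_psum n (A : 'M[int]_n) (k j : 'I_n) : int :=
  \sum_(l < n | (l <= k)%N) A l j.

Definition is_asm n (A : 'M[int]_n) : bool :=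
  [&& [forall i, forall j, A i j \in [:: 0; 1; -1]],
      [forall i, forall k, row_psum A i k \in [:: 0; 1]],
      [forall j, forall k, col_psum A k j \in [:: 0; 1]],
      [forall i, \sum_(j < n) A i j == 1]
    & [forall j, \sum_(i < n) A i j == 1]].

Definition asm (n : nat) : Type := {A : 'M[int]_n | is_asm A}.

(* Points of the square {0, ..., n+1} x {0, ..., n+1}, in (row, column)
   coordinates. Its four corners are neither interior nor boundary vertices and
   belong to no edge. *)
Definition point (n : nat) : finType := ('I_n.+2 * 'I_n.+2)%type.

(* Only meaningful for [i, j <= n.+1] (other values are sent to 0). *)
Definition pt (n i j : nat) : point n := (inord i, inord j).

Definition interior n (v : point n) : bool :=
  (1 <= v.1 <= n)%N && (1 <= v.2 <= n)%N.

Definition boundary n (v : point n) : bool :=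
  ((1 <= v.1 <= n)%N && ((v.2 == 0 :> nat) || (v.2 == n.+1 :> nat)))
  || (((v.1 == 0 :> nat) || (v.1 == n.+1 :> nat)) && (1 <= v.2 <= n)%N).

Definition hpair (n i j : nat) : {set point n} := [set pt n i j; pt n i j.+1].
Definition vpair (n i j : nat) : {set point n} := [set pt n i j; pt n i.+1 j].

Definition hedges (n : nat) : {set {set point n}} :=
  [set hpair n i.+1 j | i : 'I_n, j : 'I_n.+1].
Definition vedges (n : nat) : {set {set point n}} :=
  [set vpair n i j.+1 | i : 'I_n.+1, j : 'I_n].

Definition edge (n : nat) : finType :=
  {e : {set point n} | e \in hedges n :|: vedges n}.

Definition orientation (n : nat) : Type :=
  {o : {ffun edge n -> point n * point n} |
     [forall e, val e == [set (o e).1; (o e).2]]}.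

(* [e] goes out of [arc_tail o e] and comes in [arc_head o e]. *)
Definition arc_tail n (o : orientation n) (e : edge n) : point n := (val o e).1.
Definition arc_head n (o : orientation n) (e : edge n) : point n := (val o e).2.

Definition out_edges n (o : orientation n) (v : point n) : {set edge n} :=
  [set e | arc_tail o e == v].
Definition in_edges n (o : orientation n) (v : point n) : {set edge n} :=
  [set e | arc_head o e == v].

Definition six_vertex_state n (o : orientation n) : bool :=
  [forall v : point n, interior v ==>
     (#|in_edges o v| == 2) && (#|out_edges o v| == 2)].

Definition open_boundary n (o : orientation n) : bool :=
  [forall e : edge n, forall u : point n, forall v : point n,
     [&& interior u, boundary v & val e == [set u; v]] ==>
       ((val e \in vedges n) ==> (arc_head o e == v))
       && ((val e \in hedges n) ==> (arc_tail o e == v))].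

Definition SV (n : nat) : Type :=
  {o : orientation n | six_vertex_state o && open_boundary o}.

Section Choice.
Variable n : nat.

(* The edges at the interior vertex (i,j), with 1 <= i, j <= n. *)
Definition edgeN (i j : nat) : {set point n} := vpair n i.-1 j.
Definition edgeE (i j : nat) : {set point n} := hpair n i j.
Definition edgeS (i j : nat) : {set point n} := vpair n i j.
Definition edgeW (i j : nat) : {set point n} := hpair n i j.-1.

Definition chNE i j := [set edgeN i j; edgeE i j].
Definition chNS i j := [set edgeN i j; edgeS i j].
Definition chNW i j := [set edgeN i j; edgeW i j].
Definition chES i j := [set edgeE i j; edgeS i j].
Definition chEW i j := [set edgeE i j; edgeW i j].
Definition chSW i j := [set edgeS i j; edgeW i j].

Definition choice_at (phi : SV n) (i j : nat) : {set {set point n}} :=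
  [set val e | e in out_edges (val phi) (pt n i j)].

(* The index shift is the one of the matrices above. *)
Definition SV_mx (phi : SV n) : 'M[int]_n :=
  \matrix_(i < n, j < n)
    if choice_at phi i.+1 j.+1 == chNS i.+1 j.+1 then 1
    else if choice_at phi i.+1 j.+1 == chEW i.+1 j.+1 then -1
    else 0.

End Choice.

(* Main.v *)
Require Import Defs.
From HB Require Import structures.
From mathcomp Require Import all_boot all_order all_algebra.
From mathcomp Require Import zify.

Set Implicit Arguments.
Unset Strict Implicit.
Unset Printing Implicit Defensive.

Import Order.TTheory GRing.Theory Num.Theory.
Local Open Scope ring_scope.

(** Record an orientation by two families of bits: upward says that the vertical
edge from row i to row i+1 points up, leftward that the horizontal edge from
column j to column j+1 points left. In these terms an interior vertex has two
edges going out exactly when the flow upward + leftward is conserved there, that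
is, when
<<
  upward above - upward below = leftward on the right - leftward on the left,
>>
and going through the six local configurations shows that this common value is
1 for the choice NS, -1 for EW and 0 otherwise, hence the matrix entry
(six_vertexP, SV_mx_up, SV_mx_left). The matrix is thus the discrete derivative
of both families. The open boundary condition fixes them on the border
(open_boundaryP), so partial sums telescope: a row sum is the bit leftward, a
column sum is the negation of the bit upward (SV_row, SV_col). All claims follow
from this. The sums are 0 or 1 and the full ones are 1; the matrix determines
the bits, hence the state; the triplet of a vertex tells its four bits and so
its choice. Conversely, the partial sums of an alternating sign matrix can be
taken as the bits of an orientation (orient): both discrete derivatives being
the matrix itself, the flow is conserved. *)

(** * Points and edges of the graph *)

Lemma set2_eq (T : finType) (a b c d : T) :
  [set a; b] = [set c; d] -> (a = c /\ b = d) \/ (a = d /\ b = c).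
Proof.
move=> eq_ab_cd.
have /orP ac : (a == c) || (a == d) by rewrite -in_set2 -eq_ab_cd set21.
have /orP bc : (b == c) || (b == d) by rewrite -in_set2 -eq_ab_cd set22.
have /orP ca : (c == a) || (c == b) by rewrite -in_set2 eq_ab_cd set21.
have /orP da : (d == a) || (d == b) by rewrite -in_set2 eq_ab_cd set22.
by case: ac => /eqP ?; case: bc => /eqP ?; case: ca => /eqP ?; case: da => /eqP ?;
   subst; auto.
Qed.

Lemma set2_injr (T : finType) (a b c : T) : [set a; b] = [set a; c] -> b = c.
Proof. by case/set2_eq=> [] [] // -> ->. Qed.

Lemma eq_pt n i j i' j' :
  (i <= n.+1)%N -> (j <= n.+1)%N -> (i' <= n.+1)%N -> (j' <= n.+1)%N ->
  (pt n i j == pt n i' j') = (i == i') && (j == j').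
Proof. by move=> *; rewrite /pt xpair_eqE -!val_eqE /= !inordK. Qed.

Lemma vpair_vedges n i j :
  (i <= n)%N -> (j < n)%N -> vpair n i j.+1 \in vedges n.
Proof.
move=> le_in lt_jn; apply/imset2P.
by exists (Ordinal (le_in : i < n.+1)%N) (Ordinal lt_jn).
Qed.

Lemma hpair_hedges n i j :
  (i < n)%N -> (j <= n)%N -> hpair n i.+1 j \in hedges n.
Proof.
move=> lt_in le_jn; apply/imset2P.
by exists (Ordinal lt_in) (Ordinal (le_jn : j < n.+1)%N).
Qed.

Lemma vedgesP n s :
  s \in vedges n -> exists i j, [/\ (i <= n)%N, (j < n)%N & s = vpair n i j.+1].
Proof. by case/imset2P=> i j _ _ ->; exists i, j; split; rewrite ?leq_ord. Qed.

Lemma hedgesP n s :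
  s \in hedges n -> exists i j, [/\ (i < n)%N, (j <= n)%N & s = hpair n i.+1 j].
Proof. by case/imset2P=> i j _ _ ->; exists i, j; split; rewrite ?leq_ord. Qed.

Lemma edge_exists n (s : {set point n}) :
  s \in hedges n :|: vedges n -> exists e : edge n, val e = s.
Proof. by move=> sP; exists (exist _ s sP). Qed.

Lemma vpair_edge n i j :
  (i <= n)%N -> (j < n)%N -> exists e : edge n, val e = vpair n i j.+1.
Proof. by move=> *; apply: edge_exists; rewrite inE vpair_vedges ?orbT. Qed.

Lemma hpair_edge n i j :
  (i < n)%N -> (j <= n)%N -> exists e : edge n, val e = hpair n i.+1 j.
Proof. by move=> *; apply: edge_exists; rewrite inE hpair_hedges. Qed.

Lemma vpair_neq n i j :
  (i <= n)%N -> (j < n)%N -> pt n i j.+1 != pt n i.+1 j.+1.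
Proof. by move=> *; rewrite eq_pt //; lia. Qed.

Lemma hpair_neq n i j :
  (i < n)%N -> (j <= n)%N -> pt n i.+1 j != pt n i.+1 j.+1.
Proof. by move=> *; rewrite eq_pt //; lia. Qed.

(** * Orientations as families of bits *)

(** The second argument is a set of points rather than a term of type [edge n], so
that membership of a north, east, south or west edge in the choice at a vertex
unfolds to this relation. *)
Definition leaves n (o : orientation n) (v : point n) (s : {set point n}) :=
  s \in [set val e | e in out_edges o v].

Lemma leaves_val n (o : orientation n) v (e : edge n) :
  leaves o v (val e) = (arc_tail o e == v).
Proof. by rewrite /leaves mem_imset ?inE //; exact: val_inj. Qed.

Lemma arc_ends n (o : orientation n) (e : edge n) :
  val e = [set arc_tail o e; arc_head o e].
Proof. by apply/eqP; have /forallP := valP o; exact. Qed.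

Lemma arcE n (o : orientation n) (e : edge n) (a b : point n) :
    val e = [set a; b] -> a != b ->
  val o e = if leaves o b [set a; b] then (b, a) else (a, b).
Proof.
move=> def_e /negPf neq_ab; rewrite -def_e leaves_val.
have := arc_ends o e; rewrite def_e /arc_tail /arc_head.
by case: (val o e) => t h /= /set2_eq[] [<- <-]; rewrite ?neq_ab ?eqxx.
Qed.

Lemma leaves_other n (o : orientation n) (e : edge n) (a b : point n) :
    val e = [set a; b] -> a != b ->
  leaves o a [set a; b] = ~~ leaves o b [set a; b].
Proof.
move=> def_e neq_ab; rewrite -{1}def_e leaves_val /arc_tail (arcE o def_e neq_ab).
by case: ifP; rewrite /= ?eqxx // eq_sym (negPf neq_ab).
Qed.

(** Rows and columns of interior vertices are counted from 0, as in matrices: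
the vertical edge meant by [upward o i j] lies between the points of rows [i]
and [i.+1] in column [j.+1], with [i <= n]; dually for [leftward]. *)
Definition upward n (o : orientation n) (i j : nat) :=
  leaves o (pt n i.+1 j.+1) (vpair n i j.+1).
Definition leftward n (o : orientation n) (i j : nat) :=
  leaves o (pt n i.+1 j.+1) (hpair n i.+1 j).

(** The tail of an arc determines its head, because its edge is known. *)
Lemma orientation_ext n (o1 o2 : orientation n) :
    (forall i j, (i <= n)%N -> (j < n)%N -> upward o1 i j = upward o2 i j) ->
    (forall i j, (i < n)%N -> (j <= n)%N -> leftward o1 i j = leftward o2 i j) ->
  o1 = o2.
Proof.
move=> eq_up eq_left; apply: val_inj; apply/ffunP=> e.
have /setUP[/hedgesP|/vedgesP] := valP e; move=> [i [j [le_i le_j def_e]]].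
  rewrite !(arcE _ def_e) ?hpair_neq //.
  by have := eq_left i j le_i le_j; rewrite /leftward => ->.
rewrite !(arcE _ def_e) ?vpair_neq //.
by have := eq_up i j le_i le_j; rewrite /upward => ->.
Qed.

(** * The local configuration at an interior vertex *)

Definition star n i j : seq {set point n} :=
  [:: edgeN n i j; edgeE n i j; edgeS n i j; edgeW n i j].

Lemma star_uniq n i j : (i < n)%N -> (j < n)%N -> uniq (star n i.+1 j.+1).
Proof.
move=> lt_in lt_jn.
rewrite /= !inE !negb_or /edgeN /edgeE /edgeS /edgeW /vpair /hpair /=.
(* With the common end written first, only the neighbours are to be compared. *)
rewrite (setUC [set pt n i j.+1]) (setUC [set pt n i.+1 j]) !andbT.
by apply/and3P; split; [apply/and3P; split|apply/andP; split|];
   apply/eqP=> /set2_injr/eqP; rewrite eq_pt; lia.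
Qed.

Lemma star_edges n i j (s : {set point n}) : (i < n)%N -> (j < n)%N ->
  s \in star n i.+1 j.+1 ->
  exists2 e : edge n, val e = s & pt n i.+1 j.+1 \in val e.
Proof.
move=> lt_in lt_jn; rewrite !inE => /or4P[]/eqP->.
- have [e def_e] := vpair_edge (ltnW lt_in) lt_jn.
  by exists e; rewrite // def_e set22.
- have [e def_e] := hpair_edge lt_in lt_jn.
  by exists e; rewrite // def_e set21.
- have [e def_e] := vpair_edge lt_in lt_jn.
  by exists e; rewrite // def_e set21.
have [e def_e] := hpair_edge lt_in (ltnW lt_jn).
by exists e; rewrite // def_e set22.
Qed.

Lemma incident_star n i j (e : edge n) : (i < n)%N -> (j < n)%N ->
  pt n i.+1 j.+1 \in val e -> val e \in star n i.+1 j.+1.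
Proof.
move=> lt_in lt_jn.
have /setUP[/hedgesP|/vedgesP] := valP e; move=> [a [b [le_a le_b ->]]];
  rewrite !inE !eq_pt //; try lia.
all: case/orP=> /andP[/eqP ia /eqP jb].
- by move: ia jb => [<-] <-; rewrite eqxx !orbT.
- by move: ia jb => [<-] [<-]; rewrite eqxx !orbT.
- by move: ia jb => <- [<-]; rewrite eqxx !orbT.
by move: ia jb => [<-] [<-]; rewrite eqxx.
Qed.

Lemma card_uniq_sub (T : finType) (X : {set T}) (s : seq T) :
  uniq s -> {subset X <= s} -> #|X| = count (mem X) s.
Proof.
move=> s_uniq sXs; rewrite -size_filter -(card_uniqP (filter_uniq _ s_uniq)).
apply: eq_card => x; rewrite mem_filter /=.
by case: (boolP (x \in X)) => // /sXs ->.
Qed.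

Section Vertex.
Variables (n : nat) (o : orientation n) (i j : nat).
Hypotheses (lt_in : (i < n)%N) (lt_jn : (j < n)%N).
Let v := pt n i.+1 j.+1.
Let X := [set val e | e in out_edges o v].

Lemma out_star : {subset X <= star n i.+1 j.+1}.
Proof.
move=> s /imsetP[e]; rewrite inE => /eqP tl_e ->.
by apply: incident_star; rewrite // (arc_ends o) tl_e set21.
Qed.

Lemma leavesN : (edgeN n i.+1 j.+1 \in X) = upward o i j. Proof. by []. Qed.
Lemma leavesW : (edgeW n i.+1 j.+1 \in X) = leftward o i j. Proof. by []. Qed.

(** The bit of an edge records whether it leaves its lower (or right) end; the
vertex is the other end of its south and east edges, whence the negations here
and below. *)
Lemma leavesS : (edgeS n i.+1 j.+1 \in X) = ~~ upward o i.+1 j.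
Proof.
have [e def_e] := vpair_edge lt_in lt_jn.
by apply: (leaves_other o def_e); apply: vpair_neq.
Qed.

Lemma leavesE : (edgeE n i.+1 j.+1 \in X) = ~~ leftward o i j.+1.
Proof.
have [e def_e] := hpair_edge lt_in lt_jn.
by apply: (leaves_other o def_e); apply: hpair_neq.
Qed.

Lemma card_out :
  #|out_edges o v| =
  (upward o i j + ~~ leftward o i j.+1 + ~~ upward o i.+1 j + leftward o i j)%N.
Proof.
rewrite -(card_imset _ val_inj).
rewrite (card_uniq_sub (star_uniq lt_in lt_jn) out_star).
by rewrite /= leavesN leavesE leavesS leavesW addn0 !addnA.
Qed.

Lemma arc_neq (e : edge n) : arc_tail o e != arc_head o e.
Proof.
suff: #|val e| == 2 by rewrite (arc_ends o) cards2 eqSS eqb1.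
have /setUP[/hedgesP|/vedgesP] := valP e; move=> [a [b [le_a le_b ->]]].
  by rewrite cards2 hpair_neq.
by rewrite cards2 vpair_neq.
Qed.

(** Each of the four edges at the vertex has it as head or as tail, never as both.
So the condition on incoming edges follows from the one on outgoing edges. *)
Lemma card_in_out : (#|in_edges o v| + #|out_edges o v|)%N = 4.
Proof.
have -> : 4 = #|[set e : edge n | v \in val e]|.
  rewrite -(card_imset _ val_inj) (card_uniq_sub (star_uniq lt_in lt_jn)).
    symmetry; apply/eqP; rewrite -[4]/(size (star n i.+1 j.+1)) -all_count.
    apply/allP=> s /(star_edges lt_in lt_jn)[e <- v_e] /=.
    by rewrite mem_imset ?inE //; exact: val_inj.
  by move=> s /imsetP[e]; rewrite inE => v_e ->; exact: incident_star.
have -> : [set e : edge n | v \in val e] = in_edges o v :|: out_edges o v.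
  by apply/setP=> e; rewrite !inE (arc_ends o) in_set2 orbC ![v == _]eq_sym.
suff no_loop : in_edges o v :&: out_edges o v = set0.
  by rewrite -cardsUI no_loop cards0 addn0.
apply/setP=> e; rewrite !inE; apply/negP=> /andP[/eqP hd_e /eqP tl_e].
by have := arc_neq e; rewrite hd_e tl_e eqxx.
Qed.

End Vertex.

(** Choices as bit sequences, in the order N, E, S, W of the star: comparing two
choices becomes a computation, see [eq_flag_choice]. *)
Definition flag_choice n i j (m : bitseq) : {set {set point n}} :=
  [set s in mask m (star n i j)].

Lemma eq_flag_choice n i j m1 m2 :
    (i < n)%N -> (j < n)%N -> size m1 = 4 -> size m2 = 4 ->
  (flag_choice n i.+1 j.+1 m1 == flag_choice n i.+1 j.+1 m2) = (m1 == m2).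
Proof.
move=> lt_in lt_jn sz1 sz2; apply/eqP/eqP=> [eq_m | -> //].
have st_uniq := star_uniq lt_in lt_jn.
apply: (@eq_from_nth _ false) => [|k lt_k]; first by rewrite sz1.
have lt_k4 : (k < size (star n i.+1 j.+1))%N by rewrite sz1 in lt_k.
have /setP/(_ (nth set0 (star n i.+1 j.+1) k)) := eq_m.
by rewrite !inE !in_mask // mem_nth // index_uniq.
Qed.

Lemma choice_out n (o : orientation n) i j : (i < n)%N -> (j < n)%N ->
  [set val e | e in out_edges o (pt n i.+1 j.+1)] =
  flag_choice n i.+1 j.+1
    [:: upward o i j; ~~ leftward o i j.+1; ~~ upward o i.+1 j; leftward o i j].
Proof.
move=> lt_in lt_jn; rewrite -leavesN -leavesW -leavesS // -leavesE //.
set X := [set _ | _ in _]; apply/setP=> s.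
have -> : [:: edgeN n i.+1 j.+1 \in X; edgeE n i.+1 j.+1 \in X;
       edgeS n i.+1 j.+1 \in X; edgeW n i.+1 j.+1 \in X]
     = map (mem X) (star n i.+1 j.+1) by [].
rewrite inE -filter_mask mem_filter /=.
by case: (boolP (s \in X)) => // /(out_star lt_in lt_jn) ->.
Qed.

Lemma choicesE n i j :
 [/\ chNE n i j = flag_choice n i j [:: true; true; false; false],
     chNW n i j = flag_choice n i j [:: true; false; false; true],
     chES n i j = flag_choice n i j [:: false; true; true; false],
     chSW n i j = flag_choice n i j [:: false; false; true; true]
   & chNS n i j = flag_choice n i j [:: true; false; true; false] /\
     chEW n i j = flag_choice n i j [:: false; true; false; true]].
Proof. by split; [..|split]; apply/setP=> s; rewrite !inE. Qed.

(** The edges going out of a vertex number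
upward above + not upward below + leftward on the left + not leftward on the
right; equating this with 2 gives conservation of the flow. *)
Lemma six_vertexP n (o : orientation n) :
  six_vertex_state o <->
  (forall i j, (i < n)%N -> (j < n)%N ->
     upward o i j + leftward o i j = upward o i.+1 j + leftward o i j.+1)%N.
Proof.
have cardE i j : (i < n)%N -> (j < n)%N ->
    (#|in_edges o (pt n i.+1 j.+1)| == 2) && (#|out_edges o (pt n i.+1 j.+1)| == 2)
    = (upward o i j + leftward o i j == upward o i.+1 j + leftward o i j.+1)%N.
  move=> lt_in lt_jn; have := card_in_out o lt_in lt_jn.
  have := card_out o lt_in lt_jn.
  by case: (upward o i j) (upward o i.+1 j) (leftward o i j) (leftward o i j.+1)
    => [] [] [] [] /=; lia.
split=> [/forallP sixo i j lt_in lt_jn | flux].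
  apply/eqP; rewrite -cardE //; apply: (implyP (sixo _)).
  by rewrite /interior /pt /= !inordK; lia.
apply/forallP=> -[a b]; apply/implyP; rewrite /interior /=.
case/andP=> /andP[a_gt0 le_an] /andP[b_gt0 le_bn].
have -> : (a, b) = pt n a.-1.+1 b.-1.+1 by rewrite /pt !prednK // !inord_val.
by rewrite cardE ?flux ?eqxx //; lia.
Qed.

(** * The open boundary condition *)

Lemma head_vpair n (o : orientation n) (e : edge n) i j :
    (i <= n)%N -> (j < n)%N -> val e = vpair n i j.+1 ->
  ((arc_head o e == pt n i j.+1) = upward o i j) *
  ((arc_head o e == pt n i.+1 j.+1) = ~~ upward o i j).
Proof.
move=> le_in lt_jn def_e; have neq := vpair_neq le_in lt_jn.
rewrite /arc_head (arcE o def_e neq) -/(vpair n i j.+1) -/(upward o i j).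
by case: (upward o i j); rewrite /= eqxx ?(negPf neq) // eq_sym (negPf neq).
Qed.

Lemma tail_hpair n (o : orientation n) (e : edge n) i j :
    (i < n)%N -> (j <= n)%N -> val e = hpair n i.+1 j ->
  ((arc_tail o e == pt n i.+1 j) = ~~ leftward o i j) *
  ((arc_tail o e == pt n i.+1 j.+1) = leftward o i j).
Proof.
move=> lt_in le_jn def_e; have neq := hpair_neq lt_in le_jn.
rewrite /arc_tail (arcE o def_e neq) -/(hpair n i.+1 j) -/(leftward o i j).
by case: (leftward o i j); rewrite /= eqxx ?(negPf neq) // eq_sym (negPf neq).
Qed.

Lemma interior_pt n i j : (i <= n.+1)%N -> (j <= n.+1)%N ->
  interior (pt n i j) = (1 <= i <= n)%N && (1 <= j <= n)%N.
Proof. by move=> *; rewrite /interior /pt /= !inordK. Qed.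

Lemma boundary_pt n i j : (i <= n.+1)%N -> (j <= n.+1)%N ->
  boundary (pt n i j) =
    ((1 <= i <= n)%N && ((j == 0)%N || (j == n.+1)%N))
    || (((i == 0)%N || (i == n.+1)%N) && (1 <= j <= n)%N).
Proof. by move=> *; rewrite /boundary /pt /= !inordK. Qed.

Lemma open_boundaryP n (o : orientation n) :
  open_boundary o <->
  (forall j, (j < n)%N -> upward o 0 j /\ ~~ upward o n j) /\
  (forall i, (i < n)%N -> ~~ leftward o i 0 /\ leftward o i n).
Proof.
split=> [/forallP open_o | [open_v open_h]].
  have use u v (e : edge n) : interior u -> boundary v ->
      (val e = [set u; v] \/ val e = [set v; u]) ->
      (val e \in vedges n -> arc_head o e == v)
      /\ (val e \in hedges n -> arc_tail o e == v).
    move=> int_u bd_v uv; have := open_o e.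
    move=> /forallP/(_ u)/forallP/(_ v); rewrite int_u bd_v /=.
    have -> : val e == [set u; v] by case: uv => ->; rewrite // setUC.
    by case/andP=> /implyP hv /implyP hh; split.
  split=> k lt_kn.
    have n_gt0 : (0 < n)%N by case: (n) lt_kn.
    split.
      have [e def_e] := vpair_edge (leq0n n) lt_kn.
      rewrite -(head_vpair o _ _ def_e) //.
      apply: (proj1 (use (pt n 1 k.+1) _ _ _ _ _)); rewrite ?def_e ?vpair_vedges //;
      first [by rewrite ?interior_pt ?boundary_pt //; lia | by right].
    have [e def_e] := vpair_edge (leqnn n) lt_kn.
    rewrite -(head_vpair o _ _ def_e) //.
    apply: (proj1 (use (pt n n k.+1) _ _ _ _ _)); rewrite ?def_e ?vpair_vedges //;
      first [by rewrite ?interior_pt ?boundary_pt //; lia | by left].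
  have n_gt0 : (0 < n)%N by case: (n) lt_kn.
  split.
    have [e def_e] := hpair_edge lt_kn (leq0n n).
    rewrite -(tail_hpair o _ _ def_e) //.
    apply: (proj2 (use (pt n k.+1 1) _ _ _ _ _)); rewrite ?def_e ?hpair_hedges //;
      first [by rewrite ?interior_pt ?boundary_pt //; lia | by right].
  have [e def_e] := hpair_edge lt_kn (leqnn n).
  rewrite -(tail_hpair o _ _ def_e) //.
  apply: (proj2 (use (pt n k.+1 n) _ _ _ _ _)); rewrite ?def_e ?hpair_hedges //;
      first [by rewrite ?interior_pt ?boundary_pt //; lia | by left].
apply/forallP=> e; apply/forallP=> u; apply/forallP=> v.
apply/implyP=> /and3P[_ bd_v /eqP def_e].
apply/andP; split; apply/implyP.
  case/vedgesP=> i [j [le_in lt_jn def_e']].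
  have hd := head_vpair o le_in lt_jn def_e'.
  (* A vertical edge can have its boundary end below only in the last row, and
     above only in the first one. *)
  have := def_e; rewrite def_e'; case/set2_eq=> [[_ def_v]|[def_v _]];
    move: bd_v; rewrite -def_v hd boundary_pt; try lia.
    by move=> bd; have -> : i = n; [lia | case: (open_v j)].
  by move=> bd; have -> : i = 0%N; [lia | case: (open_v j)].
case/hedgesP=> i [j [lt_in le_jn def_e']].
have tl := tail_hpair o lt_in le_jn def_e'.
have := def_e; rewrite def_e'; case/set2_eq=> [[_ def_v]|[def_v _]];
  move: bd_v; rewrite -def_v tl boundary_pt; try lia.
  by move=> bd; have -> : j = n; [lia | case: (open_h i)].
by move=> bd; have -> : j = 0%N; [lia | case: (open_h i)].
Qed.

(** * The orientation with given bits *)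

(** Whether the edge between the neighbours [a] and [b] is directed from [a] to
[b] when [U] and [L] prescribe its bits. The predecessors undo the shift between
points and matrix indices. *)
Definition toward n (U L : nat -> nat -> bool) (a b : point n) : bool :=
  if a.2 == b.2 then
    if (a.1 < b.1)%N then ~~ U a.1 a.2.-1 else U b.1 a.2.-1
  else
    if (a.2 < b.2)%N then ~~ L a.1.-1 a.2 else L a.1.-1 b.2.

Lemma toward_vpair n U L i j : (i <= n)%N -> (j < n)%N ->
  (toward U L (pt n i j.+1) (pt n i.+1 j.+1) = ~~ U i j) *
  (toward U L (pt n i.+1 j.+1) (pt n i j.+1) = U i j).
Proof.
move=> le_in lt_jn; rewrite /toward /pt /= eqxx !inordK //; try lia.
by rewrite ltnSn ltnNge leqnSn.
Qed.

Lemma toward_hpair n U L i j : (i < n)%N -> (j <= n)%N ->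
  (toward U L (pt n i.+1 j) (pt n i.+1 j.+1) = ~~ L i j) *
  (toward U L (pt n i.+1 j.+1) (pt n i.+1 j) = L i j).
Proof.
move=> lt_in le_jn; rewrite /toward /pt /= -!val_eqE /= !inordK //; try lia.
by rewrite ltnSn [(j.+1 < j)%N]ltnNge leqnSn eqn_leq ltnn andbF eqn_leq ltnn.
Qed.

(** The default value is never reached, see [orient_funP]. *)
Definition orient_fun n U L : {ffun edge n -> point n * point n} :=
  [ffun e => odflt (pt n 0 0, pt n 0 0)
     [pick p | (val e == [set p.1; p.2]) && toward U L p.1 p.2]].

Lemma orient_funP n U L (e : edge n) (p := orient_fun n U L e) :
  (val e == [set p.1; p.2]) && toward U L p.1 p.2.
Proof.
rewrite /p ffunE; case: pickP => [q // | no_p].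
have /setUP[/hedgesP|/vedgesP] := valP e; move=> [i [j [le_i le_j def_e]]].
  have := no_p (pt n i.+1 j, pt n i.+1 j.+1).
  have := no_p (pt n i.+1 j.+1, pt n i.+1 j).
  rewrite /= [[set pt n i.+1 j.+1; _]]setUC def_e eqxx !toward_hpair //.
  by case: (L i j).
have := no_p (pt n i j.+1, pt n i.+1 j.+1).
have := no_p (pt n i.+1 j.+1, pt n i j.+1).
rewrite /= [[set pt n i.+1 j.+1; _]]setUC def_e eqxx !toward_vpair //.
by case: (U i j).
Qed.

Lemma orient_subproof n U L :
  [forall e, val e == [set (orient_fun n U L e).1; (orient_fun n U L e).2]].
Proof. by apply/forallP=> e; case/andP: (orient_funP U L e). Qed.

Definition orient n U L : orientation n :=
  exist _ (orient_fun n U L) (orient_subproof n U L).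

Lemma up_orient n U L i j : (i <= n)%N -> (j < n)%N ->
  upward (orient n U L) i j = U i j.
Proof.
move=> le_in lt_jn; have [e def_e] := vpair_edge le_in lt_jn.
have /negPf neq := vpair_neq le_in lt_jn.
rewrite /upward -def_e leaves_val /arc_tail /=.
have := orient_funP U L e; case: (orient_fun n U L e) => t h /=.
case/andP=> /eqP; rewrite def_e => /set2_eq[] [<- <-].
  by rewrite toward_vpair // neq => /negPf.
by rewrite toward_vpair // eqxx.
Qed.

Lemma left_orient n U L i j : (i < n)%N -> (j <= n)%N ->
  leftward (orient n U L) i j = L i j.
Proof.
move=> lt_in le_jn; have [e def_e] := hpair_edge lt_in le_jn.
have /negPf neq := hpair_neq lt_in le_jn.
rewrite /leftward -def_e leaves_val /arc_tail /=.
have := orient_funP U L e; case: (orient_fun n U L e) => t h /=.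
case/andP=> /eqP; rewrite def_e => /set2_eq[] [<- <-].
  by rewrite toward_hpair // neq => /negPf.
by rewrite toward_hpair // eqxx.
Qed.

(** * From states to matrices *)

Section StateToMatrix.
Variables (n : nat) (phi : SV n).
Let o := val phi.

Lemma SV_flux i j : (i < n)%N -> (j < n)%N ->
  (upward o i j + leftward o i j = upward o i.+1 j + leftward o i j.+1)%N.
Proof. by move: i j; apply/six_vertexP; case/andP: (valP phi). Qed.

Lemma SV_boundary :
  (forall j, (j < n)%N -> upward o 0 j /\ ~~ upward o n j) /\
  (forall i, (i < n)%N -> ~~ leftward o i 0 /\ leftward o i n).
Proof. by apply/open_boundaryP; case/andP: (valP phi). Qed.

(** By conservation of the flow, the bits on the left and on the right differ
only for the choices NS and EW. *)
Lemma SV_mx_left (i j : 'I_n) :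
  SV_mx phi i j = (leftward o i j.+1)%:R - (leftward o i j)%:R.
Proof.
have [_ _ _ _ [NS EW]] := choicesE n i.+1 j.+1.
rewrite mxE /choice_at choice_out // NS EW !eq_flag_choice //.
have := SV_flux (ltn_ord i) (ltn_ord j); rewrite -/o.
by case: (upward o i j) (upward o i.+1 j) (leftward o i j) (leftward o i j.+1)
  => [] [] [] [].
Qed.

Lemma SV_mx_up (i j : 'I_n) :
  SV_mx phi i j = (upward o i j)%:R - (upward o i.+1 j)%:R.
Proof.
rewrite SV_mx_left; have := SV_flux (ltn_ord i) (ltn_ord j).
by case: (upward o i j) (upward o i.+1 j) (leftward o i j) (leftward o i j.+1)
  => [] [] [] [].
Qed.

End StateToMatrix.

(** Counting the terms from 0 to [k] makes the empty and the full sum instances. *)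
Definition psum n (f : 'I_n -> int) (k : nat) : int :=
  \sum_(l < n | (l < k)%N) f l.

Lemma psum0 n (f : 'I_n -> int) : psum f 0 = 0.
Proof. by rewrite /psum big1. Qed.

Lemma psumS n (f : 'I_n -> int) (k : 'I_n) : psum f k.+1 = psum f k + f k.
Proof.
rewrite /psum (bigD1 k) //= addrC; congr (_ + _); apply: eq_bigl => l.
by rewrite ltnS [in RHS]ltn_neqAle andbC.
Qed.

Lemma psum_all n (f : 'I_n -> int) : psum f n = \sum_(l < n) f l.
Proof. by apply: eq_bigl => l; rewrite ltn_ord. Qed.

Lemma psum_telescope n (f : 'I_n -> int) (g : nat -> int) k : (k <= n)%N ->
  (forall l : 'I_n, f l = g l.+1 - g l) -> psum f k = g k - g 0.
Proof.
move=> le_kn def_f; rewrite -telescope_sumr // big_mkord.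
rewrite (big_ord_widen n (fun l => g l.+1 - g l) le_kn).
by apply: eq_bigr => l _; exact: def_f.
Qed.

Lemma row_psumE n (A : 'M[int]_n) (i k : 'I_n) : row_psum A i k = psum (A i) k.+1.
Proof. by []. Qed.

Lemma col_psumE n (A : 'M[int]_n) (k j : 'I_n) :
  col_psum A k j = psum (A^~ j) k.+1.
Proof. by []. Qed.

Lemma SV_row n (phi : SV n) (i : 'I_n) k : (k <= n)%N ->
  psum (SV_mx phi i) k = (leftward (val phi) i k)%:R.
Proof.
move=> le_kn; rewrite (psum_telescope (g := fun l => (leftward (val phi) i l)%:R)) //.
  by case: (SV_boundary phi) => _ /(_ i (ltn_ord i))[/negPf-> _]; rewrite subr0.
exact: SV_mx_left.
Qed.

Lemma SV_col n (phi : SV n) (j : 'I_n) k : (k <= n)%N ->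
  psum ((SV_mx phi)^~ j) k = (~~ upward (val phi) k j)%:R.
Proof.
move=> le_kn; rewrite (psum_telescope (g := fun l => (~~ upward (val phi) l j)%:R)) //.
  by case: (SV_boundary phi) => /(_ j (ltn_ord j))[-> _] _; rewrite subr0.
by move=> l; rewrite SV_mx_up; case: (upward _ l j) (upward _ l.+1 j) => [] [].
Qed.

Lemma SV_mx_asm n (phi : SV n) : is_asm (SV_mx phi).
Proof.
have [bd_up bd_left] := SV_boundary phi.
apply/and5P; split; apply/forallP=> i; try (apply/forallP=> k).
- rewrite SV_mx_left.
  by case: (leftward _ i k.+1) (leftward _ i k) => [] [].
- by rewrite row_psumE SV_row //; case: (leftward _ _ _).
- by rewrite col_psumE SV_col //; case: (upward _ _ _).
- by rewrite -psum_all SV_row //; case: (bd_left i (ltn_ord i)) => _ ->.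
by rewrite -psum_all SV_col //; case: (bd_up i (ltn_ord i)) => _ ->.
Qed.

Lemma SV_mx_inj n : injective (@SV_mx n).
Proof.
move=> phi psi eq_mx; apply: val_inj; apply: orientation_ext => i j le_i le_j.
  have := SV_col psi (Ordinal le_j) le_i; rewrite -eq_mx SV_col //=.
  by case: (upward _ _ _) (upward _ _ _) => [] [].
have := SV_row psi (Ordinal le_i) le_j; rewrite -eq_mx SV_row //=.
by case: (leftward _ _ _) (leftward _ _ _) => [] [].
Qed.

(** * From matrices to states *)

Section MatrixToState.
Variables (n : nat) (A : asm n).
Let M := val A.

(** The formulas of [SV_col] and [SV_row] read backwards. The column of a vertical
edge and the row of a horizontal one are matrix indices, but are natural numbers
here, as [orient] expects. *)
Definition asm_up (i j : nat) : bool :=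
  if insub j is Some j' then psum (M^~ j') i == 0 else false.
Definition asm_left (i j : nat) : bool :=
  if insub i is Some i' then psum (M i') j == 1 else false.

Lemma asm_psum :
  (forall (j : 'I_n) k, (k <= n)%N -> psum (M^~ j) k = (~~ asm_up k j)%:R) /\
  (forall (i : 'I_n) k, (k <= n)%N -> psum (M i) k = (asm_left i k)%:R).
Proof.
have /and5P[_ /forallP rowP /forallP colP _ _] := valP A.
split=> l [|k] lt_kn; rewrite /asm_up /asm_left valK ?psum0 //.
  have := forallP (colP l) (Ordinal lt_kn); rewrite col_psumE /= -/M.
  by rewrite !inE => /orP[]/eqP->.
have := forallP (rowP l) (Ordinal lt_kn); rewrite row_psumE /= -/M.
by rewrite !inE => /orP[]/eqP->.
Qed.

Lemma asm_entry (i j : 'I_n) :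
  M i j = (asm_up i j)%:R - (asm_up i.+1 j)%:R /\
  M i j = (asm_left i j.+1)%:R - (asm_left i j)%:R.
Proof.
have [col row] := asm_psum; split.
  have := psumS (M^~ j) i; rewrite !col // 1?ltnW //.
  move=> /eqP; rewrite addrC -subr_eq /= => /eqP<-.
  by case: (asm_up i j) (asm_up i.+1 j) => [] [].
have := psumS (M i) j; rewrite !row // 1?ltnW //.
by move=> /eqP; rewrite addrC -subr_eq /= => /eqP<-.
Qed.

(** Both differences of bits in [asm_entry] equal the entry, hence each other:
this is conservation of the flow. The boundary bits are the empty sums and the
full sums. *)
Lemma asm_state :
  six_vertex_state (orient n asm_up asm_left) &&
  open_boundary (orient n asm_up asm_left).
Proof.
have [col row] := asm_psum; apply/andP; split.
  apply/six_vertexP=> i j lt_in lt_jn.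
  rewrite !up_orient ?left_orient //; try exact: ltnW.
  have [/= -> /eqP] := asm_entry (Ordinal lt_in) (Ordinal lt_jn).
  by case: (asm_up i j) (asm_up i.+1 j) (asm_left i j) (asm_left i j.+1)
    => [] [] [] [].
have /and5P[_ _ _ /forallP rowP /forallP colP] := valP A.
apply: (proj2 (open_boundaryP _)); split=> k lt_kn.
  rewrite !up_orient //; have := eqP (colP (Ordinal lt_kn)).
  rewrite -psum_all col //= => asm_n.
  have := col (Ordinal lt_kn) _ (leq0n n); rewrite psum0 /=.
  by case: (asm_up n k) (asm_up 0 k) asm_n => [] [].
rewrite !left_orient //; have := eqP (rowP (Ordinal lt_kn)).
rewrite -psum_all row //= => asm_n.
have := row (Ordinal lt_kn) _ (leq0n n); rewrite psum0 /=.
by case: (asm_left k n) (asm_left k 0) asm_n => [] [].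
Qed.

Definition state_of_asm : SV n := exist _ (orient n asm_up asm_left) asm_state.

Lemma state_of_asmK : SV_mx state_of_asm = M.
Proof.
apply/matrixP=> i j; rewrite SV_mx_left /= !left_orient //; try exact: ltnW.
by case: (asm_entry i j).
Qed.

End MatrixToState.

Theorem mainTheorem1 (n : nat) (n_gt0 : (0 < n)%N) :
  (exists f_asm : forall phi : SV n, is_asm (SV_mx phi),
     bijective (fun phi : SV n => exist _ (SV_mx phi) (f_asm phi) : asm n))
  /\
  (forall (phi : SV n) (i j : 'I_n),
     let a := SV_mx phi in
     let t : int * int * int := (a i j, col_psum a i j, row_psum a i j) in
     let ch := choice_at phi i.+1 j.+1 in
     t \in [:: (0, 0, 0); (0, 0, 1); (0, 1, 0); (0, 1, 1); (1, 1, 1); (-1, 0, 0)]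
     /\ (t = (0, 0, 0) -> ch = chNE n i.+1 j.+1)
     /\ (t = (0, 0, 1) -> ch = chNW n i.+1 j.+1)
     /\ (t = (0, 1, 0) -> ch = chES n i.+1 j.+1)
     /\ (t = (0, 1, 1) -> ch = chSW n i.+1 j.+1)
     /\ (t = (1, 1, 1) -> ch = chNS n i.+1 j.+1)
     /\ (t = (-1, 0, 0) -> ch = chEW n i.+1 j.+1)).
Proof.
split.
  exists (@SV_mx_asm n); apply: (@Bijective _ _ _ (@state_of_asm n)).
    by move=> phi; apply: SV_mx_inj; rewrite state_of_asmK.
  by move=> A; apply: val_inj; rewrite /= state_of_asmK.
move=> phi i j a t ch.
have def_t : t = ((upward (val phi) i j)%:R - (upward (val phi) i.+1 j)%:R,
                  (~~ upward (val phi) i.+1 j)%:R, (leftward (val phi) i j.+1)%:R).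
  by rewrite /t /a col_psumE SV_col // row_psumE SV_row // SV_mx_up.
(* The triplet and the choice are now functions of the same four bits, and the
   flow leaves six values of these. *)
have [-> -> -> -> [-> ->]] := choicesE n i.+1 j.+1.
rewrite /ch /choice_at choice_out // {}def_t.
have := SV_flux phi (ltn_ord i) (ltn_ord j).
by case: (upward _ i j) (upward _ i.+1 j) (leftward _ i j) (leftward _ i j.+1)
  => [] [] [] [] // _; do !split=> //; move/eqP.
Qed.
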